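(* There exists $M_0<\infty$ such that for every integer $M\ge M_0$, the rotor walk on $G_M$ with the clockwise rotor mechanism and independent uniform initial rotors, started at a fixed vertex, is almost surely transient.
   Context: For an integer $M\ge 1$, $G_M$ is the square lattice $\mathbb{Z}^2$ (nearest-neighbor edges) with $M$ leaves $L_1,\dots,L_M$ (vertices of degree one) attached to every lattice vertex, all drawn between the edge to the west and the edge to the north, so that the clockwise cyclic order of the edges out of a lattice vertex is $N,E,S,W,L_1,\dots,L_M$ (then back to $N$). At a leaf there is a single outgoing edge. A rotor configuration assigns to each vertex $v$ one directed edge $\rho(v)$ out of $v$; a rotor mechanism is a cyclic permutation $\pi_v$ of the directed edges out of $v$, for each $v$ (here, the clockwise order above). Given an initial position $X_0$ and initial rotor configuration $\rho_0$, the rotor walk is defined for integers $t\ge0$ by $\rho_{t+1}(v)=\pi_v(\rho_t(v))$ if $v=X_t$, $\rho_{t+1}(v)=\rho_t(v)$ otherwise, and $X_{t+1}$ is determined by $\rho_{t+1}(X_t)=(X_t\to X_{t+1})$. Independent uniform initial rotors: the $\rho_0(v)$ are independent, each uniform among the directed edges out of $v$. The walk is recurrent if it visits every vertex infinitely often, and transient otherwise. *)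

(* Defs.v *)
From HB Require Import structures.
From mathcomp Require Import all_boot all_order all_algebra.
From mathcomp Require Import zify.
From mathcomp Require Import all_classical all_reals all_analysis.

Set Implicit Arguments.
Unset Strict Implicit.
Unset Printing Implicit Defensive.

Import GRing.Theory.
Local Open Scope classical_set_scope.
Local Open Scope ring_scope.

(* All graphs here are simple, so a directed edge out of [v] is identified    *)
(* with its head. A graph with its rotor mechanism is given by [out], where   *)
(* [out v] lists the neighbours of [v], without repetition, in rotor order;   *)
(* the mechanism at [v] is the cyclic permutation [next (out v)] of that list.*)
Section RotorWalk.
Variables (V : eqType) (out : V -> seq V).

Definition rotor_config (rho : V -> V) : Prop := forall v, rho v \in out v.

Definition rotor_step (s : V * (V -> V)) : V * (V -> V) :=
  let: (x, rho) := s in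
  let rho' v := if v == x then next (out v) (rho v) else rho v in
  (rho' x, rho').

Definition rotor_walk (x0 : V) (rho0 : V -> V) (t : nat) : V :=
  (iter t rotor_step (x0, rho0)).1.

Definition recurrent (X : nat -> V) : Prop :=
  forall v, infinite_set [set t | X t = v].

Definition transient (X : nat -> V) : Prop := ~ recurrent X.

(* The finite sets of indices in the independence rule are the duplicate-free *)
(* sequences; the sigma-algebra on [V] is the discrete one.                   *)
Definition indep_uniform_rotors (R : realType) (d : measure_display)
    (Omega : measurableType d) (P : probability Omega R)
    (rho : Omega -> V -> V) : Prop :=
  [/\ forall w, rotor_config (rho w),
      forall v (A : set V), measurable [set w | A (rho w v)],
      forall v u, u \in out v ->
        P [set w | rho w v = u] = ((size (out v))%:R^-1)%:E
    & forall (s : seq V) (A : V -> set V), uniq s ->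
        P [set w | forall v, v \in s -> A v (rho w v)] =
        (\prod_(v <- s) P [set w | A v (rho w v)])%E].

End RotorWalk.

(* [inl z] is the lattice vertex [z], and [inr (z, i)] is the i-th leaf       *)
(* attached to [z] (numbered from 0).                                         *)
Definition leafy_vertex (M : nat) : Type := ((int * int) + (int * int) * 'I_M)%type.

Definition lattice_vertex (M : nat) (x y : int) : leafy_vertex M := inl (x, y).

Definition clockwise (M : nat) (v : leafy_vertex M) : seq (leafy_vertex M) :=
  match v with
  | inl (x, y) =>
      [:: lattice_vertex M x (y + 1); lattice_vertex M (x + 1) y;
          lattice_vertex M x (y - 1); lattice_vertex M (x - 1) y]
      ++ [seq inr ((x, y), i) | i <- enum 'I_M]
  | inr (z, _) => [:: inl z]
  end.

Lemma lattice_vertex_eq M (a b c e : int) :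
  (lattice_vertex M a b == lattice_vertex M c e) = (a == c) && (b == e).
Proof. by []. Qed.

Lemma clockwise_uniq M (v : leafy_vertex M) : uniq (clockwise v).
Proof.
case: v => [[x y]|[z i]] //.
rewrite /clockwise cat_uniq map_inj_uniq ?enum_uniq => [|i j [] //].
rewrite andbT; apply/andP; split; last first.
  by apply/hasPn => u /mapP[i _ ->]; rewrite !inE.
rewrite /= !inE !lattice_vertex_eq; lia.
Qed.

Lemma clockwise_sym M (u v : leafy_vertex M) :
  (u \in clockwise v) = (v \in clockwise u).
Proof.
have leafE (z z' : int * int) (i : 'I_M) :
    (inr (z, i) \in clockwise (inl z' : leafy_vertex M)) = (z == z').
  case: z' => a b; rewrite mem_cat !inE /=.
  apply/mapP/eqP => [[j _ [->]]//|->]; by exists i; rewrite ?mem_enum.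
case: u v => [[a b]|[z i]] [[c e]|[z' i']].
- have out (p q : int) : (lattice_vertex M p q
      \in [seq (inr ((c, e), i) : leafy_vertex M) | i <- enum 'I_M]) = false.
    by apply/mapP => -[].
  have out' (p q : int) : (lattice_vertex M p q
      \in [seq (inr ((a, b), i) : leafy_vertex M) | i <- enum 'I_M]) = false.
    by apply/mapP => -[].
  rewrite -/(lattice_vertex M a b) -/(lattice_vertex M c e) !mem_cat.
  rewrite out out' !inE !lattice_vertex_eq; lia.
- by rewrite [RHS]leafE inE eq_sym.
- by rewrite [LHS]leafE inE eq_sym.
- by [].
Qed.

(* Main.v *)
Require Import Defs.
From HB Require Import structures.
From mathcomp Require Import all_boot all_order all_algebra.
From mathcomp Require Import zify ring lra.
From mathcomp Require Import all_classical all_reals all_analysis.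

Set Implicit Arguments.
Unset Strict Implicit.
Unset Printing Implicit Defensive.

(**
The walk can only be recurrent if the initial rotors contain arbitrarily large
and improbably dense clusters of atypical rotors; a Peierls count rules this
out.

Call a lattice vertex a defect if its initial rotor is one of N, E, S. A
defect has probability 3 / (4 + M). At any other vertex the lattice exits occur
in the order N, E, S, W.

Suppose that the walk is recurrent, and watch it from a late visit of its
starting point o until o has been left once along each of its edges and
reached again. During this excursion every directed edge is used at most once,
and every vertex visited earlier uses all its edges
([recurrent_excursion]).
So the edges used form a finite circulation on the lattice (leaf edges are
used in pairs and cancel). Call a vertex full if it uses its four lattice edges,
idle if it uses none, and partial otherwise. A partial vertex was not visited
before the excursion, hence still carries its initial rotor.

Let Q be a set of partial vertices that is closed under king moves to partial
vertices. Then the vertices of Q have total exit displacement zero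
([displacement]). Indeed the flow between Q and the rest of the lattice
cancels edge by edge, so that the flow inside Q is itself a circulation;
and what remains, the sum of the unit normals along the interface
between Q and the full vertices, vanishes because this interface is made of
closed curves: around a unit square meeting Q, all partial vertices are in Q.
Along the direction (1, 1), a partial vertex which is not a defect has
displacement at least 1, as it uses a nonempty proper initial segment of
N, E, S, W, and a defect has displacement at least -2. Hence at
least a third of the vertices of Q are defects ([card_le_defects]).

The same closed curves show that Q can be chosen large and close to the
origin without any planar topology: if the vertices (x, 0) with x in [0, n] are
full, then the partial vertices connected by king moves to the positive
x-axis must reach the negative x-axis, since the signed number of crossings of
the whole x-axis is zero while along its positive half one leaves the full
vertices once more than one enters them ([axis_crossing]). So there is
a king-connected Q containing some (a, 0) with n <= a < |Q|, at least a
third of which are defects ([contour]).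

A king-connected set with m elements is the trace of a king walk of length
2 m, so the number of pairs (Q, set of defects in Q) with a < m is at most K ^ m for
some constant K, while for each the defects have probability at most
(3 / (4 + M)) ^ (m / 3). For M large the sum over m is finite, and the
Borel-Cantelli lemma concludes.
*)

(** * Cyclic orders *)

Lemma next_cons_iter (T : eqType) (x : T) (s : seq T) (j : nat) :
  uniq (x :: s) -> (j <= size s)%N ->
  iter j.+1 (next (x :: s)) x = nth x (rcons s x) j.
Proof.
move=> us; elim: j => [_|j IH js].
  rewrite -[iter 1 _ _]/(next (x :: s) x) next_nth mem_head /= eqxx.
  by case: s us => //= y s _.
rewrite iterS IH 1?ltnW// nth_rcons js next_nth.
have sj : nth x s j \in s by rewrite mem_nth.
rewrite inE sj orbT /= ifN; last first.
  by apply: contraTneq sj => <-; case/andP: us.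
rewrite index_uniq//; last by case/andP: us.
rewrite nth_rcons; case: (ltnP j.+1 (size s)) => // sj'.
by rewrite nth_default// if_same.
Qed.

(** The successive exits from a vertex whose rotor starts at [x] form the
enumeration [r] of the outgoing edges, which ends with [x] itself. *)
Lemma rotor_order (T : eqType) (s : seq T) (x : T) :
  uniq s -> x \in s -> exists r : seq T,
  [/\ uniq r, r =i s, size r = size s, (forall d, nth d r (size s).-1 = x)
    & forall j, (j < size s)%N -> iter j.+1 (next s) x = nth x r j].
Proof.
move=> us xs; have [i s' sE] := rot_to xs.
have us' : uniq (x :: s') by rewrite -sE rot_uniq.
have ss : size s = (size s').+1 by rewrite -(size_rot i) sE.
exists (rcons s' x); split.
- by rewrite -rot1_cons rot_uniq.
- by move=> y; rewrite -rot1_cons mem_rot -sE mem_rot.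
- by rewrite size_rcons.
- by move=> d; rewrite ss /= nth_rcons ltnn eqxx.
- move=> j; rewrite ss ltnS => js; rewrite -next_cons_iter//.
  by apply: eq_iter => y; rewrite -sE next_rot.
Qed.

Lemma next_nth_uniq (T : eqType) (d : T) (p : seq T) (i : nat) :
  uniq p -> (i.+1 < size p)%N -> next p (nth d p i) = nth d p i.+1.
Proof.
move=> up ip; rewrite next_nth mem_nth ?index_uniq//; try exact: ltnW.
by case: p ip {up} => // y p ip; rewrite (set_nth_default d).
Qed.

Lemma sum_count (T : Type) (r : seq T) (a : pred T) :
  (\sum_(w <- r) a w = count a r)%N.
Proof. by rewrite -sum1_count [RHS]big_mkcond. Qed.

Lemma sum_eq_uniq (T : eqType) (r : seq T) (x : T) :
  uniq r -> (\sum_(w <- r) (x == w) = (x \in r))%N.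
Proof.
move=> ur; rewrite -count_uniq_mem// -sum_count.
by apply: eq_bigr => w _; rewrite eq_sym.
Qed.

(** * Excursions of a rotor walk *)

Section Walk.
Variables (V : eqType) (out : V -> seq V).
Hypothesis out_uniq : forall v, uniq (out v).
Hypothesis out_sym : forall u v, (u \in out v) = (v \in out u).
Local Notation deg v := (size (out v)).

Section FixedStart.
Variables (o : V) (rho : V -> V).
Hypothesis rho_config : rotor_config out rho.
Local Notation X := (rotor_walk out o rho).

Definition rotors t := (iter t (rotor_step out) (o, rho)).2.
Definition exits t v := (\sum_(0 <= s < t) (X s == v))%N.
Definition entries t v := (\sum_(0 <= s < t) (X s.+1 == v))%N.
Definition uses t v w := (\sum_(0 <= s < t) ((X s == v) && (X s.+1 == w)))%N.

Lemma rotorsS t v :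
  rotors t.+1 v = if v == X t then next (out v) (rotors t v) else rotors t v.
Proof. by rewrite /rotors /rotor_walk iterS; case: (iter _ _ _). Qed.

Lemma rotor_walkS t : X t.+1 = rotors t.+1 (X t).
Proof. by rewrite /rotors /rotor_walk iterS; case: (iter _ _ _). Qed.

Lemma exitsS t v : exits t.+1 v = (exits t v + (X t == v))%N.
Proof. by rewrite /exits big_nat_recr. Qed.

Lemma rotorsE t v : rotors t v = iter (exits t v) (next (out v)) (rho v).
Proof.
elim: t => [|t IH]; first by rewrite /exits big_geq.
rewrite rotorsS exitsS eq_sym; case: eqP => _; last by rewrite addn0.
by rewrite addn1 iterS IH.
Qed.

Lemma rotors_config t : rotor_config out (rotors t).
Proof.
by move=> v; rewrite rotorsE; elim: exits => //= n IH; rewrite mem_next.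
Qed.

Lemma rotor_walk_out t : X t.+1 \in out (X t).
Proof. by rewrite rotor_walkS; exact: rotors_config. Qed.

(** Which edges out of [v] have been used depends on the past only through the
number of exits from [v]. *)
Lemma usesE t v w :
  uses t v w =
  (\sum_(0 <= j < exits t v) (iter j.+1 (next (out v)) (rho v) == w))%N.
Proof.
elim: t => [|t IH]; first by rewrite /uses /exits !big_geq.
rewrite /uses big_nat_recr//= -/(uses t v w) IH exitsS.
case: eqP => [Xt|_] /=; last by rewrite !addn0.
rewrite addn1 big_nat_recr//=; congr (_ + (_ == _))%N.
by rewrite rotor_walkS Xt rotorsE exitsS Xt eqxx addn1.
Qed.

Lemma entriesE t v : (entries t v + (o == v) = exits t v + (X t == v))%N.
Proof.
elim: t => [|t IH]; first by rewrite /entries /exits !big_geq.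
by rewrite exitsS -IH /entries big_nat_recr//= addnAC.
Qed.

Lemma sum_uses_out t v : (\sum_(w <- out v) uses t v w = exits t v)%N.
Proof.
rewrite exchange_big/=; apply: eq_bigr => s _.
case: eqP => [<-|_] /=; last by rewrite big1.
by rewrite sum_eq_uniq// rotor_walk_out.
Qed.

Lemma sum_uses_in t v : (\sum_(w <- out v) uses t w v = entries t v)%N.
Proof.
rewrite exchange_big/=; apply: eq_bigr => s _.
under eq_bigr do rewrite andbC.
case: eqP => [<-|_] /=; last by rewrite big1.
by rewrite sum_eq_uniq// out_sym rotor_walk_out.
Qed.

Lemma uses_le1 t v w : (exits t v <= deg v)%N -> (uses t v w <= 1)%N.
Proof.
move=> tv; have [r [ur _ sr _ rE]] := rotor_order (out_uniq v) (rho_config v).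
rewrite usesE; apply: (@leq_trans (\sum_(0 <= j < size r) (nth w r j == w))%N).
  rewrite sr (big_cat_nat (leq0n _) tv); apply: leq_trans (leq_addr _ _).
  rewrite big_nat_cond [leqRHS]big_nat_cond.
  apply: leq_sum => j /andP[/andP[_ jt] _].
  by rewrite rE ?(leq_trans jt)// (set_nth_default w)// sr (leq_trans jt).
rewrite -(big_nth w predT (fun y => nat_of_bool (y == w))).
by rewrite sum_count count_uniq_mem// leq_b1.
Qed.

Lemma uses_gt0 t v w : reflect
  (exists2 j, (j < exits t v)%N & iter j.+1 (next (out v)) (rho v) = w)
  (0 < uses t v w)%N.
Proof.
rewrite usesE big_mkord lt0n sum_nat_eq0; apply: (iffP idP).
  move=> /forallPn[j]; rewrite /= eqb0 negbK => /eqP jw.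
  by exists (val j); [exact: ltn_ord|exact: jw].
move=> [j jt jw]; apply/forallPn; exists (Ordinal jt).
by rewrite /= eqb0 negbK; apply/eqP.
Qed.

(** The rotor leaves its initial position [rho v] only to come back last, so
apart from this position no edge is used before its predecessor. *)
Lemma uses_prev t v b : (0 < uses t v (next (out v) b))%N -> rho v != b ->
  (0 < uses t v b)%N.
Proof.
move=> /uses_gt0[[|j] jt /(congr1 (prev (out v)))].
  by rewrite /= !prev_next// => ->; rewrite eqxx.
rewrite iterS !prev_next// => jb _.
by apply/uses_gt0; exists j => //; exact: ltnW.
Qed.

Lemma uses_out t v w : (0 < uses t v w)%N -> w \in out v.
Proof.
move=> /uses_gt0[j _ <-]; elim: j.+1 => [|i IH]; first exact: rho_config.
by rewrite iterS mem_next.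
Qed.

Lemma uses_support t v w :
  (0 < uses t v w)%N -> v \in [seq X s | s <- iota 0 t].
Proof.
rewrite /uses big_mkord lt0n sum_nat_eq0 => /forallPn[s].
rewrite /= eqb0 negbK => /andP[/eqP<- _].
by apply/mapP; exists (val s); rewrite ?mem_iota//; exact: ltn_ord.
Qed.

(** The first vertex [v != o] to be left more than [deg v] times would have
been entered more than [deg v] times, hence twice along the same edge, from a
vertex left too often before. *)
Lemma excursion_exits_le t v : (exits t o <= deg o)%N -> (exits t v <= deg v)%N.
Proof.
elim: t v => [|t IH] v; first by move=> _; rewrite /exits big_geq.
have [-> //|vo ot] := eqVneq v o.
have to : (exits t o <= deg o)%N by rewrite (leq_trans _ ot)// exitsS leq_addr.
rewrite exitsS; have [Xt|_] := eqVneq (X t) v; last by rewrite addn0 IH.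
have := entriesE t v; rewrite Xt eqxx eq_sym (negPf vo) addn0 => <-.
rewrite -sum_uses_in -sum1_size; apply: leq_sum => w _.
exact/uses_le1/IH.
Qed.

(** Entries equal exits at the end of an excursion, and each of the [deg v]
edges into [v] is used at most once. *)
Lemma excursion_full_in t v w : X t = o -> (exits t o <= deg o)%N ->
  exits t v = deg v -> w \in out v -> (0 < uses t w v)%N.
Proof.
move=> Xt ot tv wv; have := entriesE t v; rewrite Xt => /addIn.
rewrite -sum_uses_in tv => sumE; rewrite lt0n; apply/negP => /eqP w0.
have : (\sum_(u <- out v) uses t u v <= \sum_(u <- rem w (out v)) 1)%N.
  rewrite (big_rem w)//= w0 add0n; apply: leq_sum => u _.
  exact/uses_le1/excursion_exits_le.
rewrite sumE sum1_size size_rem// leqNgt ltn_predL.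
by case: (out v) wv.
Qed.

Lemma uses_last_full t v : (0 < uses t v (rho v))%N -> (deg v <= exits t v)%N.
Proof.
move=> /uses_gt0[j jt jE].
have [r [ur _ sr rl rE]] := rotor_order (out_uniq v) (rho_config v).
have [jd|] := ltnP j (deg v); last by move=> /leq_trans; apply; exact: ltnW.
move: jE; rewrite rE// -[RHS](rl (rho v)) => /eqP.
rewrite nth_uniq// ?sr//; last by rewrite ltn_predL (leq_ltn_trans _ jd).
by move=> /eqP jE; rewrite -(ltn_predK jd) -jE.
Qed.

Lemma full_uses t v w :
  (deg v <= exits t v)%N -> w \in out v -> (0 < uses t v w)%N.
Proof.
move=> tv wv.
have [r [_ r_out sr _ rE]] := rotor_order (out_uniq v) (rho_config v).
have jr : (index w r < size r)%N by rewrite index_mem r_out.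
apply/uses_gt0; exists (index w r); first by rewrite (leq_trans _ tv)// -sr.
by rewrite rE -?sr// nth_index ?r_out.
Qed.

Lemma exits_return k : (forall T, exists2 t, (T <= t)%N & X t = o) ->
  exists2 t, X t = o & exits t o = k.
Proof.
move=> io; elim: k => [|k [t Xt tk]].
  by exists 0%N; rewrite // /exits big_geq.
have ex : exists u, (t < u)%N && (X u == o).
  by have [u tu Xu] := io t.+1; exists u; rewrite tu Xu eqxx.
case: (ex_minnP ex) => u /andP[tu /eqP Xu] umin; exists u => //.
rewrite /exits (big_cat_nat (leq0n _) tu)/= -/(exits t.+1 o) exitsS tk Xt eqxx.
rewrite addn1 big_nat_cond big1 ?addn0// => s /andP[/andP[ts su] _].
by apply/eqP; rewrite eqb0; apply: contraTN su => Xs; rewrite -leqNgt umin ?ts.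
Qed.

End FixedStart.

Lemma rotor_walk_shift o rho T t :
  rotor_walk out o rho (T + t) =
  rotor_walk out (rotor_walk out o rho T) (rotors o rho T) t.
Proof.
rewrite /rotor_walk /rotors addnC iterD.
by congr (iter t _ _).1; rewrite -surjective_pairing.
Qed.

(** The relation [use] consists of the edges used by an excursion from [o] that
begins at a visit [T0 >= T] of [o]. The last property refers to the rotors [rho]
at time 0: a vertex which does not use all its edges is not visited
before [T0], so its rotor has not moved. *)
Theorem recurrent_excursion o rho T : rotor_config out rho ->
  recurrent (rotor_walk out o rho) ->
  exists (use : V -> V -> bool) (F : seq V),
  [/\ forall v w, use v w -> (w \in out v) && (v \in F),
      forall v, (\sum_(w <- out v) use v w = \sum_(w <- out v) use w v)%N,
      forall s w, (s <= T)%N -> w \in out (rotor_walk out o rho s) ->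
        use (rotor_walk out o rho s) w
    & forall v b, ~~ all (use v) (out v) -> rho v != b ->
        use v (next (out v) b) -> use v b].
Proof.
move=> rho_config rec.
have io v t : exists2 u, (t <= u)%N & rotor_walk out o rho u = v.
  apply: contrapT => h; apply: (rec v); apply: (sub_finite_set (B := `I_t)).
    by move=> u /= uv; rewrite ltnNge; apply/negP => tu; apply: h; exists u.
  exact: finite_II.
have [T0 TT0 XT0] := io o T.
pose sigma := rotors o rho T0.
have sigma_config : rotor_config out sigma by exact: rotors_config.
have shift t : rotor_walk out o rho (T0 + t) = rotor_walk out o sigma t.
  by rewrite rotor_walk_shift XT0.
have [T1 XT1 eT1] : exists2 t, rotor_walk out o sigma t = o
    & exits o sigma t o = deg o.
  apply: exits_return => t; have [u tu Xu] := io o (T0 + t)%N.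
  exists (u - T0)%N; first by lia.
  by rewrite -shift subnKC//; lia.
have le_deg v : (exits o sigma T1 v <= deg v)%N.
  by apply: excursion_exits_le; rewrite ?eT1.
have full_in v w : exits o sigma T1 v = deg v -> w \in out v ->
    (0 < uses o sigma T1 w v)%N.
  by apply: excursion_full_in; rewrite ?eT1.
(* By downward induction on s: if s is the last visit of v before T0, the
   rotor at v points to the next vertex w of the walk, which is o or is visited
   later. By induction w is entered along all edges, among them the edge from v
   to w, which is the last one in the rotor order of v. *)
have visited s : (s < T0)%N ->
    exits o sigma T1 (rotor_walk out o rho s) = deg (rotor_walk out o rho s).
  move: {2}(T0 - s)%N (leqnn (T0 - s)) => k; elim: k s => [|k IH] s.
    by lia.
  move=> sk sT; set v := rotor_walk out o rho s.
  have [/existsP[u /andP[su /eqP uv]]|last] :=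
      boolP [exists u : 'I_T0, (s < u)%N && (rotor_walk out o rho u == v)].
    by rewrite -uv; apply: IH => //; lia.
  have sigmaE : sigma v = rotor_walk out o rho s.+1.
    rewrite rotor_walkS -/v /sigma !rotorsE /exits (big_cat_nat (leq0n _) sT)/=.
    congr (iter _ _ _).
    rewrite [X in (_ + X)%N]big_nat_cond [X in (_ + X)%N]big1 ?addn0//.
    move=> u /andP[/andP[su uT] _]; apply/eqP; rewrite eqb0.
    apply: contraNN last => uv; apply/existsP; exists (Ordinal uT) => /=.
    by rewrite su.
  apply/eqP; rewrite eqn_leq le_deg/= uses_last_full// full_in//; last first.
    by rewrite out_sym; exact: sigma_config.
  rewrite sigmaE; move: sT; rewrite leq_eqVlt => /predU1P[->|sT].
    by rewrite XT0.
  by apply: IH; lia.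
exists (fun v w => 0 < uses o sigma T1 v w)%N.
exists [seq rotor_walk out o sigma s | s <- iota 0 T1]; split.
- by move=> v w vw; rewrite (uses_out sigma_config vw) (uses_support vw).
- have b01 v w : (0 < uses o sigma T1 v w)%N = uses o sigma T1 v w :> nat.
    by have := uses_le1 (o := o) sigma_config w (le_deg v); case: uses => [|[]].
  move=> v; under eq_bigr do rewrite b01; under [RHS]eq_bigr do rewrite b01.
  rewrite sum_uses_in// sum_uses_out//.
  by have := entriesE o sigma T1 v; rewrite XT1 => /addIn.
- move=> s w sT sw; have [sT0|] := ltnP s T0.
    by apply: full_uses; rewrite ?visited.
  move=> T0s; have sE : s = T0 by lia.
  by move: sw; rewrite sE XT0 => ow; apply: full_uses; rewrite ?eT1.
- move=> v b nfull rb vb; apply: (uses_prev vb); move: rb.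
  rewrite /sigma rotorsE.
  suff -> : exits o rho T0 v = 0%N by [].
  apply/eqP; rewrite sum_nat_seq_eq0; apply/allP => s; rewrite mem_index_iota.
  move=> sT; rewrite eqb0; apply: contraNN nfull => /eqP <-.
  by apply/allP => w sw; apply: full_uses; rewrite ?visited.
Qed.

End Walk.

Import Order.TTheory GRing.Theory Num.Theory.
Local Open Scope classical_set_scope.
Local Open Scope ring_scope.

(** * Divergence-free flows on the square lattice *)

Definition int_range (L : nat) : seq int :=
  [seq i%:Z - L%:Z | i <- iota 0 L.*2.+1].

Arguments int_range : simpl never.

Lemma mem_int_range L x : (x \in int_range L) = (`|x| <= L%:Z).
Proof.
apply/mapP/idP => [[i]|xL]; first by rewrite mem_iota => iL ->; lia.
exists (absz (x + L%:Z)); last by lia.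
by rewrite mem_iota; lia.
Qed.

Lemma int_range_uniq L : uniq (int_range L).
Proof. by rewrite map_inj_uniq ?iota_uniq// => i j; lia. Qed.

Lemma telescope_int_range L (g : int -> int) :
  \sum_(x <- int_range L) (g (x + 1) - g x) = g (L%:Z + 1) - g (- L%:Z).
Proof.
rewrite big_map -[L.*2.+1]subn0 -/(index_iota 0 L.*2.+1).
rewrite (eq_bigr (fun i : nat => g (i.+1%:Z - L%:Z) - g (i%:Z - L%:Z))).
  rewrite (telescope_sumr (fun i : nat => g (i%:Z - L%:Z)))//.
  by congr (g _ - g _); lia.
by move=> i _; congr (g _ - g _); lia.
Qed.

Lemma shift_invariant_const (r : int -> int) :
  (forall y, r (y + 1) = r y) -> forall y y', r y = r y'.
Proof.
move=> rS; suff r0 y : r y = r 0 by move=> y y'; rewrite !r0.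
elim/int_rect: y => [//|n IH|n IH].
  by rewrite -IH -[RHS]rS; congr r; lia.
by rewrite -IH -[LHS]rS; congr r; lia.
Qed.

(** A divergence-free flow with finite support has no flux through a horizontal
line: the flux does not depend on the line. Here [a] counts the
flow up through the sites of a row, and [b] is the horizontal flow up to sign
and translation. *)
Lemma divfree_row_sum L (a b : int -> int -> int) (y0 : int) :
  (forall x y, a x (y + 1) - a x y = b (x + 1) y - b x y) ->
  (forall x, a x y0 = 0) ->
  (forall y, b (L%:Z + 1) y = 0) -> (forall y, b (- L%:Z) y = 0) ->
  forall y, \sum_(x <- int_range L) a x y = 0.
Proof.
move=> ab a0 bR bL y.
rewrite (@shift_invariant_const (fun y => \sum_(x <- int_range L) a x y)
  _ y y0).
  by rewrite big1.
move=> {}y; apply/eqP; rewrite -subr_eq0 -sumrB; apply/eqP.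
under eq_bigr do rewrite ab.
by rewrite telescope_int_range bR bL subrr.
Qed.

(** * Full, idle and partial vertices of a circulation *)

(** The four functions tell which of the edges leaving [(x, y)] to the north,
east, south and west are used. *)
Section Circulation.
Variables (N E S W : int -> int -> bool).

Definition balanced := forall x y,
  (N x y + E x y + S x y + W x y =
   N x (y - 1) + E (x - 1) y + S x (y + 1) + W (x + 1) y)%N.

Definition full x y := [&& N x y, E x y, S x y & W x y].
Definition idle x y := ~~ [|| N x y, E x y, S x y | W x y].
Definition partial x y := ~~ full x y && ~~ idle x y.

Definition within (L : nat) := forall x y,
  ~~ idle x y -> (`|x| < L%:Z) && (`|y| < L%:Z).

Lemma full_in x y : balanced -> full x y ->
  [&& N x (y - 1), E (x - 1) y, S x (y + 1) & W (x + 1) y].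
Proof.
move=> /(_ x y) + /and4P[n e s w]; rewrite n e s w.
by case: (N x (y - 1)) (E (x - 1) y) (S x (y + 1)) (W (x + 1) y) =>
  [] [] [] [].
Qed.

Lemma idle_in x y : balanced -> idle x y ->
  ~~ [|| N x (y - 1), E (x - 1) y, S x (y + 1) | W (x + 1) y].
Proof.
move=> /(_ x y) + /norP[/negPf n /norP[/negPf e /norP[/negPf s /negPf w]]].
rewrite n e s w.
by case: (N x (y - 1)) (E (x - 1) y) (S x (y + 1)) (W (x + 1) y) =>
  [] [] [] [].
Qed.

(** A union of king-connected components of the set of partial vertices. *)
Definition king_closed (Q : int -> int -> bool) :=
  (forall x y, Q x y -> partial x y) /\
  (forall x y x' y', Q x y -> partial x' y' ->
     `|x - x'| <= 1 -> `|y - y'| <= 1 -> Q x' y').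

Lemma king_closed_outside L Q x y : within L -> king_closed Q ->
  (L%:Z <= `|x|) || (L%:Z <= `|y|) -> Q x y = false.
Proof. by move=> supp Qcl xy; apply/negP => /Qcl.1/andP[_ /supp]; lia. Qed.

End Circulation.

(** * The boundary between partial and full vertices *)

(** Two neighbouring vertices have a unit of boundary between them, with a sign,
if one is in [Q] and the other is full. *)
Definition crossing (q f q' f' : bool) : int := (q && f')%:R - (q' && f)%:R.

(** Around a unit square that meets [Q], a full vertex has only neighbours that
are full or in [Q], and then each [crossing] is the difference of the two
indicators of fullness: its circulation around the square vanishes. The
vertices 1, 2, 3, 4 are the southwest, southeast, northwest and northeast
corners. *)
Lemma plaquette (f1 f2 f3 f4 q1 q2 q3 q4 : bool) :
  [|| q1, q2, q3 | q4] ->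
  ~~ (q1 && f1) -> ~~ (q2 && f2) -> ~~ (q3 && f3) -> ~~ (q4 && f4) ->
  (f1 ==> f2 || q2) -> (f1 ==> f3 || q3) ->
  (f2 ==> f1 || q1) -> (f2 ==> f4 || q4) ->
  (f3 ==> f1 || q1) -> (f3 ==> f4 || q4) ->
  (f4 ==> f3 || q3) -> (f4 ==> f2 || q2) ->
  crossing q3 f3 q4 f4 - crossing q1 f1 q2 f2 =
  crossing q2 f2 q4 f4 - crossing q1 f1 q3 f3.
Proof.
rewrite /crossing.
by case: q1 => /=; case: q2 => /=; case: f1 => //=; case: f2 => //=;
  case: q3 => /=; case: f3 => //=; case: q4 => /=; case: f4.
Qed.

Section BoundaryFlow.
Variables (N E S W : int -> int -> bool) (L : nat) (Q : int -> int -> bool).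
Hypothesis bal : balanced N E S W.
Hypothesis supp : within N E S W L.
Hypothesis Qcl : king_closed N E S W Q.
Local Notation full := (full N E S W).
Local Notation idle := (idle N E S W).
Local Notation partial := (partial N E S W).

Let Qpart x y : Q x y -> partial x y. Proof. by case: Qcl => + _; apply. Qed.

Let Q0 x y : (L%:Z <= `|x|) || (L%:Z <= `|y|) -> Q x y = false.
Proof. exact: (king_closed_outside supp Qcl). Qed.

(** A vertex outside [Q] next to a vertex of [Q] is full or idle, and then uses
the edge between them in both directions or in neither. *)
Lemma edge_vertical x y :
  Q x y != Q x (y + 1) ->
  [/\ N x y = S x (y + 1), ~~ Q x y -> full x y = N x y
    & ~~ Q x (y + 1) -> full x (y + 1) = N x y].
Proof.
move=> QQ.
have fv u v : ~~ partial u v -> full u v || idle u v.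
  by rewrite /partial negb_and !negbK.
case Qxy: (Q x y) QQ; case Qxy1: (Q x (y + 1)) => // _.
- have /fv/orP[f|v] : ~~ partial x (y + 1).
    by apply/negP => /(Qcl.2 _ _ _ _ Qxy); rewrite Qxy1; lia.
  + have /and4P[+ _ _ _] := full_in bal f.
    by rewrite addrK => ->; move: (f) => /and4P[_ _ -> _]; split.
  + have /norP[+ _] := idle_in bal v; rewrite addrK => /negPf->.
    move: v; rewrite /idle /full => /norP[/negPf-> /norP[_ /norP[/negPf-> _]]].
    by split.
- have /fv/orP[f|v] : ~~ partial x y.
    by apply/negP => /(Qcl.2 _ _ _ _ Qxy1); rewrite Qxy; lia.
  + have /and4P[_ _ -> _] := full_in bal f.
    by rewrite f; move: f => /and4P[-> _ _ _]; split.
  + have /norP[_ /norP[_ /norP[/negPf-> _]]] := idle_in bal v.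
    move: v; rewrite /idle /full => /norP[/negPf-> _].
    by split.
Qed.

(** A full vertex sends a particle to all its neighbours, so none is idle. *)
Lemma full_next x y x' y' : full x y -> `|x - x'| + `|y - y'| = 1 ->
  full x' y' || partial x' y'.
Proof.
move=> f xy; suff nv : ~~ idle x' y' by rewrite /partial nv andbT orbN.
have /and4P[i1 i2 i3 i4] := full_in bal f; rewrite /idle negbK.
have : [\/ x' = x /\ y' = y - 1, x' = x /\ y' = y + 1,
           x' = x - 1 /\ y' = y | x' = x + 1 /\ y' = y].
  case: (ltgtP x x') => xx.
  - by apply: Or44; lia.
  - by apply: Or43; lia.
  - by case: (ltgtP y y') => yy; [apply: Or42|apply: Or41|]; lia.
by case=> -[-> ->]; rewrite ?i1 ?i2 ?i3 ?i4 ?orbT.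
Qed.

Definition upper_boundary x y :=
  crossing (Q x y) (full x y) (Q x (y + 1)) (full x (y + 1)).
Definition right_boundary x y :=
  crossing (Q x y) (full x y) (Q (x + 1) y) (full (x + 1) y).
Local Notation H := upper_boundary.
Local Notation V := right_boundary.

(** The boundary, seen as a union of curves on the dual lattice, has no end. *)
Lemma boundary_flow x y : V x (y + 1) - V x y = H (x + 1) y - H x y.
Proof.
pose any := [|| Q x y, Q (x + 1) y, Q x (y + 1) | Q (x + 1) (y + 1)].
have partQ u v : any -> partial u v ->
    (u == x) || (u == x + 1) -> (v == y) || (v == y + 1) -> Q u v.
  move=> a p hu hv.
  by case/or4P: a => /(Qcl.2 _ _ _ _) => /(_ u v p); apply; lia.
have adj u v u' v' : any -> `|u - u'| + `|v - v'| = 1 ->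
    (u' == x) || (u' == x + 1) -> (v' == y) || (v' == y + 1) ->
    full u v ==> full u' v' || Q u' v'.
  move=> a d hu hv; apply/implyP => f.
  case/orP: (full_next f d) => [->//|p].
  by rewrite partQ ?orbT.
have QF u v : ~~ (Q u v && full u v).
  by apply/negP => /andP[/Qpart/andP[/negPf->]].
have [anyT|] := boolP any; last first.
  rewrite /H /V /crossing.
  by move=> /norP[/negPf-> /norP[/negPf-> /norP[/negPf-> /negPf->]]].
by apply: plaquette; rewrite ?QF//; apply: adj => //; lia.
Qed.

Lemma right_boundary_row_sum y : \sum_(x <- int_range L) V x y = 0.
Proof.
apply: (divfree_row_sum (b := H) (y0 := L%:Z)) => [||v|v].
- exact: boundary_flow.
- by move=> x; rewrite /V /crossing !Q0//; lia.
- by rewrite /H /crossing !Q0//; lia.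
- by rewrite /H /crossing !Q0//; lia.
Qed.

Lemma upper_boundary_col_sum x : \sum_(y <- int_range L) H x y = 0.
Proof.
apply: (divfree_row_sum (a := fun y x => H x y) (b := fun y x => V x y)
  (y0 := L%:Z)) => [||v|v].
- by move=> u v; rewrite boundary_flow.
- by move=> u; rewrite /H /crossing !Q0//; lia.
- by rewrite /V /crossing !Q0//; lia.
- by rewrite /V /crossing !Q0//; lia.
Qed.

End BoundaryFlow.

(** Reflecting the lattice in its diagonal exchanges north with east and
south with west, which spares the horizontal copy of each vertical
argument. *)
Definition transpose T (f : int -> int -> T) x y := f y x.
Local Notation "f ^~T" := (transpose f) (at level 2, format "f ^~T").

Lemma balanced_transpose N E S W :
  balanced N E S W -> balanced E^~T N^~T W^~T S^~T.
Proof. by move=> bal x y; have := bal y x; rewrite /transpose; lia. Qed.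

Lemma full_transpose N E S W x y :
  full E^~T N^~T W^~T S^~T x y = full N E S W y x.
Proof. by rewrite /full /transpose; case: N E S W => [] [] [] []. Qed.

Lemma idle_transpose N E S W x y :
  idle E^~T N^~T W^~T S^~T x y = idle N E S W y x.
Proof. by rewrite /idle /transpose; case: N E S W => [] [] [] []. Qed.

Lemma partial_transpose N E S W x y :
  partial E^~T N^~T W^~T S^~T x y = partial N E S W y x.
Proof. by rewrite {1}/partial full_transpose idle_transpose. Qed.

Lemma king_closed_transpose N E S W Q :
  king_closed N E S W Q -> king_closed E^~T N^~T W^~T S^~T Q^~T.
Proof.
case=> Qp Qk; split=> [x y /Qp|x y x' y' q]; rewrite partial_transpose//.
by move=> p dx dy; exact: (Qk _ _ _ _ q p).
Qed.

Lemma within_transpose N E S W L :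
  within N E S W L -> within E^~T N^~T W^~T S^~T L.
Proof. by move=> supp x y; rewrite idle_transpose => /supp; rewrite andbC. Qed.

(** * Displacement and number of defects *)

Section VerticalDisplacement.
Variables (N E S W : int -> int -> bool) (L : nat) (Q : int -> int -> bool).
Hypothesis bal : balanced N E S W.
Hypothesis supp : within N E S W L.
Hypothesis Qcl : king_closed N E S W Q.

Local Notation box_sum f :=
  (\sum_(x <- int_range L) \sum_(y <- int_range L) f x y).

Let Q0 x y : (L%:Z <= `|x|) || (L%:Z <= `|y|) -> Q x y = false.
Proof. exact: (king_closed_outside supp Qcl). Qed.

Lemma edge_horizontal x y :
  Q x y != Q (x + 1) y -> E x y = W (x + 1) y.
Proof.
by case/(edge_vertical (balanced_transpose bal) (king_closed_transpose Qcl)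
  (x := y) (y := x)).
Qed.

(* Net flow along the upward and rightward edges with both ends in Q; an edge
   leaving Q has no net flow, so that its tail or its head may be tested for
   membership. *)
Let JN x y : int := (Q x y)%:R * ((N x y)%:R - (S x (y + 1))%:R).
Let JE x y : int := (Q x y)%:R * ((E x y)%:R - (W (x + 1) y)%:R).

Let JN_tail x y : JN x y = (Q x (y + 1))%:R * ((N x y)%:R - (S x (y + 1))%:R).
Proof.
rewrite /JN; have [-> //|/(edge_vertical bal Qcl)[-> _ _]] :=
  eqVneq (Q x y) (Q x (y + 1)).
by rewrite subrr !mulr0.
Qed.

Let JE_tail x y : JE x y = (Q (x + 1) y)%:R * ((E x y)%:R - (W (x + 1) y)%:R).
Proof.
rewrite /JE; have [-> //|/edge_horizontal->] := eqVneq (Q x y) (Q (x + 1) y).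
by rewrite subrr !mulr0.
Qed.

Lemma vertical_flow_row_sum y : \sum_(x <- int_range L) JN x y = 0.
Proof.
apply: (divfree_row_sum (b := fun x y => - JE (x - 1) (y + 1))
  (y0 := L%:Z)) => [u v|u|v|v].
- rewrite (JN_tail u v) addrK.
  rewrite (JE_tail (u - 1)) subrK /JN /JE.
  case: (Q u (v + 1)) => /=; rewrite ?mul0r ?subrr// ?mul1r.
  move/(congr1 (fun n => n%:R : int)): (bal u (v + 1)).
  by rewrite !natrD addrK; lra.
- by rewrite /JN Q0 ?mul0r//; lia.
- by rewrite /JE Q0 ?mul0r//; lia.
- by rewrite /JE Q0 ?mul0r//; lia.
Qed.

Lemma vertical_displacement :
  box_sum (fun x y => (Q x y)%:R * ((N x y)%:R - (S x y)%:R : int)) = 0.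
Proof.
pose H := upper_boundary N E S W Q.
pose G x y : int := (Q x y)%:R * (S x y)%:R.
have eqH x y : H x y = (Q x y)%:R * (S x (y + 1))%:R - G x (y + 1).
  have QF u v : Q u v -> full N E S W u v = false.
    by move=> /Qcl.1/andP[/negPf].
  rewrite /H /G /upper_boundary /crossing.
  have := @edge_vertical _ _ _ _ _ bal Qcl x y.
  case Q1: (Q x y); case Q2: (Q x (y + 1)) => //=.
  - by rewrite !QF// subrr subrr.
  - by case=> // NS _ ->//; rewrite NS mul1r mul0r.
  - by case=> // NS ->// _; rewrite NS mul1r mul0r.
  - by rewrite !mul0r.
(* Q * (N - S) is the net flow JN inside Q, plus the boundary of Q, plus a
   difference that telescopes along the columns. *)
transitivity (box_sum (fun x y => JN x y + H x y + (G x (y + 1) - G x y))).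
  by apply: eq_bigr => x _; apply: eq_bigr => y _; rewrite eqH /JN /G; ring.
under eq_bigr do rewrite big_split/= big_split/= telescope_int_range.
rewrite big_split/= big_split/= exchange_big/=.
rewrite big1 => [|y _]; last exact: vertical_flow_row_sum.
rewrite big1 => [|x _]; last exact: (upper_boundary_col_sum bal supp Qcl).
by rewrite big1 => [|x _]; rewrite ?add0r// /G !Q0 ?mul0r ?subrr//; lia.
Qed.

End VerticalDisplacement.

Section Displacement.
Variables (N E S W : int -> int -> bool) (L : nat) (Q : int -> int -> bool).
Hypothesis bal : balanced N E S W.
Hypothesis supp : within N E S W L.
Hypothesis Qcl : king_closed N E S W Q.

Lemma displacement :
  \sum_(x <- int_range L) \sum_(y <- int_range L) (Q x y)%:R *
    ((N x y)%:R - (S x y)%:R + ((E x y)%:R - (W x y)%:R) : int) = 0.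
Proof.
under eq_bigr do under eq_bigr do rewrite mulrDr.
under eq_bigr do rewrite big_split/=.
rewrite big_split/= (vertical_displacement bal supp Qcl) exchange_big/=.
by rewrite (vertical_displacement (balanced_transpose bal)
  (within_transpose supp) (king_closed_transpose Qcl)).
Qed.

(** In the direction (1, 1), a partial vertex obeying the order N, E, S, W moves
by at least 1 and a defect by at least -2, and the moves add up to 0. *)
Lemma card_le_defects (defect : int -> int -> bool) :
  (forall x y, Q x y -> ~~ defect x y ->
     [/\ E x y -> N x y, S x y -> E x y & W x y -> S x y]) ->
  (\sum_(x <- int_range L) \sum_(y <- int_range L) (Q x y)%:R <=
   3 * \sum_(x <- int_range L) \sum_(y <- int_range L) (Q x y && defect x y)%:R
   :> int).
Proof.
move=> order; rewrite -subr_le0 -[leRHS]displacement.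
rewrite mulr_sumr -sumrB; apply: ler_sum => x _.
rewrite mulr_sumr -sumrB; apply: ler_sum => y _.
have := order x y; case q: (Q x y) => /=; last by rewrite mulr0 mul0r.
have := Qcl.1 _ _ q; rewrite /partial /full /idle.
case: (defect x y) => [_ _|].
  by case: (N x y) (E x y) (S x y) (W x y) => [] [] [] [].
by case: (N x y) (E x y) (S x y) (W x y) => [] [] [] []//= _ /(_ isT isT)[];
  do 3?[by move=> /(_ isT)|move=> ?].
Qed.

(** The total boundary flux through the x-axis is 0. If [Q] contained no vertex
[(x, 0)] with [x < 0], this flux would be carried by [x >= 0], where every
transition between full and other vertices is a crossing of [Q]; these add up
to -1, as [(0, 0)] is full and far vertices are not. *)
Lemma axis_crossing : full N E S W 0 0 ->
  (forall x, 0 < x -> partial N E S W x 0 -> Q x 0) ->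
  exists2 x, x < 0 & Q x 0.
Proof.
move=> f0 Qpos; apply: contrapT => noneg.
have Qneg x : x <= 0 -> Q x 0 = false.
  move=> x0; apply/negP => q; have [xn|xz] := ltrP x 0.
    by apply: noneg; exists x.
  have xE : x = 0 by lia.
  by move: q; rewrite xE => /Qcl.1/andP[/negP].
(* Fullness on the axis, made constant for x < 0, so that the flux of the whole
   row is the telescoping sum of the increments of G. *)
pose G x : int := (full N E S W (if x < 0 then 0 else x) 0)%:R.
have Gneg x : x <= 0 -> G x = (full N E S W 0 0)%:R.
  by rewrite /G; case: ltrP => // x0 x0'; have -> : x = 0 by lia.
have Gpos x : 0 <= x -> G x = (full N E S W x 0)%:R.
  by rewrite /G; case: ltrP => //; lia.
have : \sum_(x <- int_range L) (G (x + 1) - G x) = 0.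
  rewrite -[RHS](right_boundary_row_sum bal supp Qcl 0); apply: eq_bigr => x _.
  rewrite /right_boundary /crossing; have [xn|x0] := ltrP x 0.
    by rewrite !Gneg ?Qneg ?subrr//; lia.
  rewrite !Gpos; [|lia|lia].
  have QF u : Q u 0 -> full N E S W u 0 = false by move=> /Qcl.1/andP[/negPf].
  have a1 := @full_next _ _ _ _ bal x 0 (x + 1) 0.
  have a2 := @full_next _ _ _ _ bal (x + 1) 0 x 0.
  case f1: (full N E S W x 0); case f2: (full N E S W (x + 1) 0).
  - by have := QF x; have := QF (x + 1); rewrite f1 f2;
    case: (Q x 0) => [_ /(_ isT)//|]; case: (Q (x + 1) 0) => [/(_ isT)//|].
  - have /orP[|p] := a1 f1 ltac:(lia); first by rewrite f2.
    by rewrite (Qpos _ _ p) ?andbF//; lia.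
  - have /orP[|p] := a2 f2 ltac:(lia); first by rewrite f1.
    have xp : 0 < x by rewrite lt_neqAle x0 andbT; apply/eqP => xE;
      rewrite -xE f0 in f1.
    by rewrite (Qpos _ xp p) andbF.
  - by rewrite !andbF.
rewrite telescope_int_range Gpos ?Gneg; [|lia|lia].
have -> : full N E S W (L%:Z + 1) 0 = false.
  apply/negP => f.
  have /supp : ~~ idle N E S W (L%:Z + 1) 0.
    by rewrite /idle negbK; case/and4P: f => ->.
  by lia.
by rewrite f0.
Qed.

End Displacement.

(** * King-connected sets and their encoding *)

Definition king (u v : int * int) := (`|u.1 - v.1| <= 1) && (`|u.2 - v.2| <= 1).

Lemma king_sym : symmetric king.
Proof. by move=> u v; rewrite /king; lia. Qed.

Lemma king_refl : reflexive king.
Proof. by move=> u; rewrite /king; lia. Qed.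

Section Reachability.
Variables (T : eqType) (e : rel T).

Definition reaches (P : pred T) u v :=
  exists p, [/\ path e u p, all P (u :: p) & last u p = v].

Lemma reaches_refl (P : pred T) u : P u -> reaches P u u.
Proof. by move=> Pu; exists [::]; rewrite /= Pu. Qed.

Lemma reaches_step (P : pred T) u v w :
  reaches P u v -> P w -> e v w -> reaches P u w.
Proof.
move=> [p [ep Pp lp]] Pw evw; exists (rcons p w).
by rewrite rcons_path lp ep evw -rcons_cons all_rcons Pp Pw last_rcons.
Qed.

Lemma reaches_end (P : pred T) u v : reaches P u v -> P v.
Proof. by move=> [p [_ /allP Pp <-]]; apply: Pp; exact: mem_last. Qed.

Lemma reaches_confine (P : pred T) u v :
  reaches P u v -> reaches (fun w => `[< reaches P u w >]) u v.
Proof.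
move=> [p]; elim/last_ind: p v => [|p w IH] v [ep Pp lp].
  rewrite -lp; apply/reaches_refl/asboolP/reaches_refl.
  by case/andP: Pp.
move: ep Pp lp; rewrite rcons_path -rcons_cons all_rcons last_rcons.
move=> /andP[ep ew] /andP[Pw Pp] <-.
have h : reaches P u (last u p) by exists p.
apply: (reaches_step (IH _ _) _ ew); first by split.
by apply/asboolP; exact: (reaches_step h Pw ew).
Qed.

Hypotheses (e_sym : symmetric e) (e_refl : reflexive e).

Lemma reaches_exit (P : pred T) (s : pred T) u v : reaches P u v ->
  s u -> ~~ s v -> exists t w, [/\ s t, ~~ s w, P w & e t w].
Proof.
move=> [p]; elim: p u => [|w p IH] u [/=].
  by move=> _ _ -> ->.
move=> /andP[euw ep] /andP[_ Pp] lp su sv.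
have [sw|sw] := boolP (s w); first by apply: (IH w).
by exists u, w; case/andP: Pp.
Qed.

(** The walk goes around a spanning tree of [q]: to add a new vertex [w]
adjacent to a visited [t], replace one occurrence of [t] by the detour
[t, w, t]. It starts with two steps staying at [u], so that its length is
exactly twice the number of vertices. *)
Lemma covering_walk (q : seq T) u :
  uniq q -> u \in q -> (forall v, v \in q -> reaches (mem q) u v) ->
  exists p, [/\ path e u p, size p = (size q).*2 & p =i q].
Proof.
move=> q_uniq uq conn.
suff grow k : (0 < k <= size q)%N -> exists p,
    [/\ path e u p, size p = k.*2, {subset p <= q}, u \in p
      & size (undup p) = k].
  have [|p [ep sp pq _ up]] := grow (size q).
    by rewrite leqnn andbT; case: (q) uq.
  exists p; split=> // v; apply/idP/idP => [/pq//|].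
  have [|| _ eqm] := @uniq_min_size _ (undup p) q (undup_uniq p).
  - by move=> w; rewrite mem_undup; exact: pq.
  - by rewrite up.
  by rewrite -eqm mem_undup.
elim: k => // -[_ _|k /(_ _)/[swap]].
  exists [:: u; u]; rewrite /= !e_refl mem_head inE eqxx/=.
  by split=> // v; rewrite !inE orbb => /eqP->.
move=> /andP[_ kq] [|p [ep sp pq up upk]]; first exact: ltnW.
have [v vq vp] : exists2 v, v \in q & v \notin p.
  apply/hasP; rewrite has_predC; apply/negP => /allP qp.
  have : (size q <= size (undup p))%N.
    by apply: uniq_leq_size => // v /qp; rewrite mem_undup.
  by rewrite upk leqNgt kq.
have [t [w [tp wp wq etw]]] := reaches_exit (conn v vq) (s := mem p) up vp.
have [p1 [p2 pE]] : exists p1 p2, p = p1 ++ t :: p2.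
  exists (take (index t p) p), (drop (index t p).+1 p).
  by rewrite -[X in X :: _](nth_index u tp) -drop_nth ?index_mem ?cat_take_drop.
have memE : p1 ++ t :: w :: t :: p2 =i w :: p.
  by move=> z; rewrite pE !(inE, mem_cat); case: (z == t);
    case: (z == w); case: (z \in p1); rewrite ?orbT.
exists (p1 ++ t :: w :: t :: p2); split.
- move: ep; rewrite pE !cat_path /= => /and3P[-> -> ->].
  by rewrite etw e_sym etw.
- by move: sp; rewrite pE !size_cat /=; lia.
- by move=> z; rewrite memE inE => /predU1P[->//|/pq].
- by rewrite memE inE up orbT.
- have := perm_size (uniq_perm (undup_uniq (p1 ++ t :: w :: t :: p2))
    (s2 := w :: undup p) _ _).
  rewrite /= undup_uniq mem_undup wp upk; apply=> // z.
  by rewrite mem_undup memE !inE mem_undup.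
Qed.

End Reachability.

Section Contour.
Variables (N E S W : int -> int -> bool) (L n : nat).
Variable defect : int -> int -> bool.
Hypothesis bal : balanced N E S W.
Hypothesis supp : within N E S W L.
Hypothesis axis_full : forall x : int, 0 <= x <= n%:Z -> full N E S W x 0.
Hypothesis order : forall x y, partial N E S W x y -> ~~ defect x y ->
  [/\ E x y -> N x y, S x y -> E x y & W x y -> S x y].

Let P (v : int * int) := partial N E S W v.1 v.2.

(** The bound [a < size q] comes from [q] containing [(a, 0)] and meeting the
negative x-axis: by king steps one cannot jump over a column. *)
Theorem contour : exists (a : nat) (q : seq (int * int)),
  [/\ (n <= a < size q)%N, uniq q, (a%:Z, 0) \in q,
      (size q <= 3 * count (fun v => defect v.1 v.2) q)%N
    & forall v, v \in q -> reaches king (mem q) (a%:Z, 0) v].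
Proof.
pose Z (x y : int) :=
  `[< exists2 a : int, 0 < a & reaches king P (a, 0) (x, y) >].
have Zcl : king_closed N E S W Z.
  split=> [x y /asboolP[a _ /reaches_end//]|x y x' y' /asboolP[a a0 r] p dx dy].
  apply/asboolP; exists a => //; apply: (reaches_step r) => //.
  by rewrite /king dx.
have [x x0 /asboolP[b b0 rb]] : exists2 x : int, x < 0 & Z x 0.
  apply: (axis_crossing bal supp Zcl); first by apply: axis_full; lia.
  by move=> x x0 px; apply/asboolP; exists x => //; exact: reaches_refl.
have Pb : P (b, 0) by case: rb => p [_ /andP[]].
have nb : n%:Z < b.
  rewrite ltNge; apply/negP => bn; move: Pb => /andP[/negP + _]; apply.
  by rewrite /=; apply: axis_full; lia.
case: b => // a in b0 rb Pb nb *.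
pose Q (x y : int) := `[< reaches king P (a%:Z, 0) (x, y) >].
have Qcl : king_closed N E S W Q.
  split=> [u v /asboolP/reaches_end//|u v u' v' /asboolP r p dx dy].
  by apply/asboolP; apply: (reaches_step r) => //; rewrite /king dx.
pose q :=
  [seq v <- [seq (u, v) | u <- int_range L, v <- int_range L] | Q v.1 v.2].
have mem_q v : (v \in q) = Q v.1 v.2.
  rewrite mem_filter; case Qv: (Q v.1 v.2); last by [].
  rewrite andTb.
  have /andP[_ /supp vL] := Qcl.1 _ _ Qv.
  by apply/allpairsPdep; exists v.1, v.2; rewrite !mem_int_range;
    split; [lia|lia|case: (v)].
have q_uniq : uniq q.
  by rewrite filter_uniq// allpairs_uniq ?int_range_uniq// => -[? ?] [? ?].
have mem_qE : (fun v => `[< reaches king P (a%:Z, 0) v >]) = mem q.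
  by apply/funext => -[u v]; rewrite /= mem_q.
have aq : (a%:Z, 0) \in q by rewrite mem_q; apply/asboolP/reaches_refl.
exists a, q; split=> //.
- rewrite (_ : (n <= a)%N); last by lia.
  rewrite -(size_map (fun v => v.1)) -[X in (X <= _)%N](size_iota 0).
  rewrite -(size_map (fun i : nat => i%:Z)); apply: uniq_leq_size.
    by rewrite map_inj_uniq ?iota_uniq// => i j [].
  move=> _ /mapP[i + ->]; rewrite mem_iota leq0n add0n ltnS leq_eqVlt.
  move=> /orP[/eqP->|ia]; first by apply/mapP; exists (a%:Z, 0).
  (* The step of the path that first leaves the columns to the right of i ends
     in column i. *)
  have := reaches_confine rb; rewrite mem_qE.
  move=> /(@reaches_exit _ _ _ (fun v => i%:Z < v.1)).
  have -> : i%:Z < (a%:Z, 0 : int).1 by rewrite /=; lia.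
  have -> : ~~ (i%:Z < (x, 0 : int).1) by rewrite /=; lia.
  move=> /(_ isT isT)[t [w [ti wi wq /andP[+ _]]]] => tw.
  by apply/mapP; exists w => //; move: tw ti wi => /=; lia.
- have := card_le_defects bal supp Qcl (fun u v h => order (Qcl.1 u v h)).
  have sumE (f : int -> int -> bool) :
      \sum_(u <- int_range L) \sum_(v <- int_range L) (f u v)%:R =
      (count (fun v => f v.1 v.2)
         [seq (u, v) | u <- int_range L, v <- int_range L])%:R :> int.
    rewrite -sum1_count natr_sum [RHS]big_mkcond big_allpairs/=.
    by apply: eq_bigr => u _; apply: eq_bigr => v _; case: f.
  rewrite !sumE size_filter count_filter.
  rewrite -natrM ler_nat.
  rewrite (@eq_count _ (predI _ _) (fun v => Q v.1 v.2 && defect v.1 v.2))//.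
  by move=> v; rewrite /= andbC.
- move=> v; rewrite mem_q => /asboolP; rewrite -surjective_pairing.
  by move=> /reaches_confine; rewrite mem_qE.
Qed.

End Contour.

(** The digits 0, 1, 2 stand for the increments -1, 0, 1. *)
Definition king_move (v : int * int) (d : 'I_3 * 'I_3) : int * int :=
  (v.1 + d.1%:Z - 1, v.2 + d.2%:Z - 1).

Lemma king_path_code u p :
  path king u p -> exists2 c, size c = size p & scanl king_move u c = p.
Proof.
elim: p u => [|v p IH] u /=; first by exists [::].
move=> /andP[/andP[dx dy] /IH[c sc cp]].
have hx : (absz (v.1 - u.1 + 1)%R < 3)%N by lia.
have hy : (absz (v.2 - u.2 + 1)%R < 3)%N by lia.
exists ((Ordinal hx, Ordinal hy) :: c); first by rewrite /= sc.
rewrite /=; suff -> : king_move u (Ordinal hx, Ordinal hy) = v by rewrite cp.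
rewrite /king_move /= [RHS]surjective_pairing; congr (_, _); lia.
Qed.

Definition marked_sites u (c : seq ('I_3 * 'I_3)) (b : bitseq) :=
  undup (mask b (scanl king_move u c)).

(** The form of a contour suited to a union bound: [m] is the size of the
connected set, [c] encodes a king walk covering it from [(a, 0)], and [b] marks
the defects among the steps of the walk. The marked sites alone are kept, since
only they are atypical. *)
Definition has_coded_contour (defect : int -> int -> bool) (n : nat) :=
  exists m a c b, [/\ (n <= m)%N, (a <= m)%N, size c = m.*2, size b = m.*2
    & let s := marked_sites (a%:Z, 0) c b in
      (m <= 3 * size s)%N /\ {in s, forall v, defect v.1 v.2}].

Theorem coded_contour N E S W L n defect :
  balanced N E S W -> within N E S W L ->
  (forall x : int, 0 <= x <= n%:Z -> full N E S W x 0) ->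
  (forall x y, partial N E S W x y -> ~~ defect x y ->
    [/\ E x y -> N x y, S x y -> E x y & W x y -> S x y]) ->
  has_coded_contour defect n.
Proof.
move=> bal supp axis order.
have [a [q [/andP[na aq] uq q0 sq conn]]] := contour bal supp axis order.
have [p [ep sp pq]] := covering_walk king_sym king_refl uq q0 conn.
have [c sc cp] := king_path_code ep.
exists (size q), a, c, (map (fun v => defect v.1 v.2) p).
split; rewrite ?size_map ?sc ?sp//.
- exact: (leq_trans na (ltnW aq)).
- exact: ltnW.
rewrite /marked_sites cp -filter_mask; split.
  apply: (leq_trans sq); rewrite leq_mul2l/= -size_filter.
  apply: uniq_leq_size; first exact: filter_uniq.
  by move=> v; rewrite mem_undup !mem_filter pq.
by move=> v; rewrite mem_undup mem_filter => /andP[].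
Qed.

(** * From the leafy lattice to the square lattice *)

(** The first three entries of the clockwise order are N, E and S. From any
other rotor position the next lattice exit is the northern one. *)
Definition defect M (rho : leafy_vertex M -> leafy_vertex M) (x y : int) :=
  rho (lattice_vertex M x y) \in take 3 (clockwise (lattice_vertex M x y)).

Theorem recurrent_contour M (o : leafy_vertex M) rho n :
  rotor_config (@clockwise M) rho ->
  recurrent (rotor_walk (@clockwise M) o rho) ->
  has_coded_contour (defect rho) n.
Proof.
move=> rho_config rec; pose v x y := lattice_vertex M x y.
have [T axisT] : exists T, forall i, (i <= n)%N ->
    exists2 s, (s <= T)%N & rotor_walk (@clockwise M) o rho s = v i%:Z 0.
  elim: (n) => [|k [T IH]].
    have /infinite_setN0[s /= sv] := rec (v 0 0).
    by exists s => i; rewrite leqn0 => /eqP->; exists s.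
  have /infinite_setN0[s /= sv] := rec (v k.+1%:Z 0).
  exists (maxn s T) => i; rewrite leq_eqVlt => /predU1P[->|].
    by exists s => //; rewrite leq_maxl.
  by move=> /IH[t tT tv]; exists t => //; rewrite leq_max tT orbT.
have [use [F [useF bal axis order]]] :=
  recurrent_excursion (@clockwise_uniq M) (@clockwise_sym M) T rho_config rec.
pose N x y := use (v x y) (v x (y + 1)).
pose E x y := use (v x y) (v (x + 1) y).
pose S x y := use (v x y) (v x (y - 1)).
pose W x y := use (v x y) (v (x - 1) y).
have outE x y : clockwise (v x y) =
    [:: v x (y + 1); v (x + 1) y; v x (y - 1); v (x - 1) y] ++
    [seq inr ((x, y), i) | i <- enum 'I_M] by [].
have outN x y i : (i < 3)%N -> next (clockwise (v x y))
    (nth (v x y) (clockwise (v x y)) i) = nth (v x y) (clockwise (v x y)) i.+1.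
  move=> i3; apply: next_nth_uniq; first exact: clockwise_uniq.
  by rewrite outE size_cat /=; lia.
pose norm (u : leafy_vertex M) : nat :=
  if u is inl z then (absz z.1 + absz z.2)%N else 0%N.
pose L := (\max_(u <- F) norm u).+1.
apply: (@coded_contour N E S W L n (defect rho)).
- move=> x y; have := bal (v x y); rewrite outE !big_cat /= !big_cons !big_nil.
  have -> : N x (y - 1) = use (v x (y - 1)) (v x y) by rewrite /N subrK.
  have -> : E (x - 1) y = use (v (x - 1) y) (v x y) by rewrite /E subrK.
  have -> : S x (y + 1) = use (v x (y + 1)) (v x y) by rewrite /S addrK.
  have -> : W (x + 1) y = use (v (x + 1) y) (v x y) by rewrite /W addrK.
  rewrite /N /E /S /W !big_map.
  (* A leaf is left as often as it is entered. *)
  under [in RHS]eq_bigr => i _.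
    have := bal (inr ((x, y), i)); rewrite /clockwise !big_seq1 => ->.
    over.
  by rewrite -/(v x y) => /eqP; rewrite eqn_add2r => /eqP; lia.
- move=> x y; rewrite /idle negbK => h.
  have vF : v x y \in F by case/or4P: h => /useF/andP[].
  have := @leq_bigmax_seq _ F xpredT norm _ vF isT.
  rewrite -/(\max_(u <- F) norm u) /L.
  by set mx := (\max_(u <- F) _) => /=; lia.
- move=> x x0n; have [|s sT sv] := axisT (absz x); first by lia.
  have {sv}sv : rotor_walk (@clockwise M) o rho s = v x 0.
    by rewrite sv; congr v; lia.
  have used w : w \in clockwise (v x 0) -> use (v x 0) w.
    by rewrite -sv; exact: axis.
  by rewrite /full /N /E /S /W !used// outE !inE eqxx ?orbT.
- move=> x y xy nd.
  have nfull : ~~ all (use (v x y)) (clockwise (v x y)).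
    apply: contraTN xy => /allP used; rewrite /partial negb_and negbK.
    by rewrite /full /N /E /S /W !used// outE !inE eqxx ?orbT.
  have step i : (i < 3)%N ->
      use (v x y) (nth (v x y) (clockwise (v x y)) i.+1) ->
      use (v x y) (nth (v x y) (clockwise (v x y)) i).
    move=> i3; rewrite -outN//; apply: order => //.
    apply: contraNneq nd => h; rewrite /defect h.
    rewrite -(nth_take (n0 := 3))// mem_nth// outE.
  by split; [exact: (@step 0%N)|exact: (@step 1%N)|exact: (@step 2%N)].
Qed.

(** * Probability of a contour *)

Lemma measure_bigsetU_le_sum d (T : measurableType d) (R : realType)
    (mu : {measure set T -> \bar R}) (I : Type) (r : seq I) (p : pred I)
    (F : I -> set T) :
  (forall i, measurable (F i)) ->
  (mu (\big[setU/set0]_(i <- r | p i) F i) <= \sum_(i <- r | p i) mu (F i))%E.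
Proof.
move=> mF; elim: r => [|i r IH]; first by rewrite !big_nil measure0.
rewrite !big_cons; case: (p i) => //.
apply: (le_trans (measureU2 _ _ _)) => //; first exact: bigsetU_measurable.
by rewrite leeD2l.
Qed.

(** A contour of size [m] is encoded by the starting abscissa, the walk and the
marks of [has_coded_contour]. *)
Definition contour_code m :=
  ('I_m.+1 * (m.*2).-tuple ('I_3 * 'I_3) * (m.*2).-tuple bool)%type.

Lemma card_contour_code : exists2 K : nat, (0 < K)%N &
  forall m, (#|{: contour_code m}| <= K ^ m)%N.
Proof.
(* The factor 2 absorbs the m + 1 starting points, as m < 2 ^ m. *)
exists (2 * (3 * 3) ^ 2 * 2 ^ 2)%N => // m.
rewrite !card_prod !card_tuple card_prod !card_ord card_bool.
rewrite -!muln2 -!(mulnC 2) !expnM !expnMn.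
by rewrite !leq_mul// ltn_expl.
Qed.

Section Defects.
Variables (R : realType) (M : nat) (d : measure_display).
Variables (Omega : measurableType d) (P : probability Omega R).
Variable rho : Omega -> leafy_vertex M -> leafy_vertex M.
Hypothesis rhoP : indep_uniform_rotors (@clockwise M) P rho.

Let defects (s : seq (int * int)) : set Omega :=
  [set w | {in s, forall z, defect (rho w) z.1 z.2}].

Lemma measurable_defects s : measurable (defects s).
Proof.
case: rhoP => _ mrho _ _.
elim: s => [|z s IH]; first by rewrite (_ : defects _ = setT)// eqEsubset.
rewrite (_ : defects _ = [set w | defect (rho w) z.1 z.2] `&` defects s).
  apply: measurableI => //.
  exact: (mrho (lattice_vertex M z.1 z.2) (fun u => u \in take 3 _)).
apply/seteqP; split=> w /=.
  by move=> h; split=> [|u us]; apply: h; rewrite ?mem_head// inE us orbT.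
by move=> [hz hs] u; rewrite inE => /predU1P[->//|/hs].
Qed.

Lemma defect_probability z :
  (P [set w | defect (rho w) z.1 z.2] <= (3%:R / (4 + M)%:R)%:E)%E.
Proof.
case: rhoP => _ mrho unif _; pose v := lattice_vertex M z.1 z.2.
rewrite /defect -/v.
have sub : {subset take 3 (clockwise v) <= clockwise v} by exact: mem_take.
have -> : 3%:R = (size (take 3 (clockwise v)))%:R :> R by [].
have szv : size (clockwise v) = (4 + M)%N.
  by rewrite /v /clockwise size_cat size_map size_enum_ord.
rewrite -szv; elim: (take 3 (clockwise v)) sub => [_|u r IH sub].
  by rewrite (_ : [set _ | _] = set0) ?measure0 ?mul0r//; apply/seteqP; split.
rewrite (_ : [set _ | _] = [set w | rho w v = u] `|` [set w | rho w v \in r]).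
  apply: (le_trans (measureU2 _ _ _)).
  - exact: (mrho v (fun x => x = u)).
  - exact: (mrho v (fun x => x \in r)).
  - rewrite -[size (u :: r)]/(size r).+1 mulrS mulrDl mul1r EFinD leeD//.
      by rewrite -(unif v u) ?sub ?mem_head.
    by apply: IH => x xr; apply: sub; rewrite inE xr orbT.
apply/seteqP; split=> w /=; first by rewrite inE => /predU1P[]; [left|right].
by case=> [->|]; rewrite inE ?eqxx// => ->; rewrite orbT.
Qed.

Lemma defects_probability s (e : R) : uniq s -> 3%:R / (4 + M)%:R <= e ->
  (P (defects s) <= (e ^+ size s)%:E)%E.
Proof.
move=> us Me; case: rhoP => _ _ _ indep.
have v_inj : injective (fun z : int * int => lattice_vertex M z.1 z.2).
  by move=> [x y] [x' y'] [-> ->].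
have := indep (map (fun z => lattice_vertex M z.1 z.2) s)
  (fun v u => u \in take 3 (clockwise v)).
rewrite map_inj_uniq// big_map => /(_ us).
rewrite (_ : [set _ | _] = defects s).
  move=> ->; elim: s {us} => [|z s IH]; first by rewrite big_nil expr0.
  rewrite big_cons exprS EFinM; apply: lee_pmul => //.
  - by rewrite prode_ge0.
  - exact: (le_trans (defect_probability z)).
apply/seteqP; split=> w /= h.
  by move=> z zs; apply: h; exact: (map_f (fun z => lattice_vertex M z.1 z.2)).
by move=> _ /mapP[z zs ->]; exact: h.
Qed.

Let sites m (k : contour_code m) := marked_sites (k.1.1%:Z, 0) k.1.2 k.2.

Let contours m : set Omega :=
  \big[setU/set0]_(k : contour_code m | (m <= 3 * size (sites k))%N)
    defects (sites k).

Variable K : nat.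
Hypothesis K_gt0 : (0 < K)%N.
Hypothesis card_code : forall m, (#|{: contour_code m}| <= K ^ m)%N.
(* The cube compensates for defects making up only a third of a contour, and the
   factor 2 leaves a summable geometric series after the count of codes. *)
Hypothesis defect_le : 3%:R / (4 + M)%:R <= ((2 * K%:R)^-1) ^+ 3 :> R.

Lemma contours_probability m : (P (contours m) <= ((2^-1) ^+ m)%:E)%E.
Proof.
set e : R := (2 * K%:R)^-1.
have e0 : 0 <= e by rewrite invr_ge0 mulr_ge0.
have e1 : e <= 1 by rewrite invf_le1 ?mulr_gt0 ?ltr0n// -natrM ler1n muln_gt0.
apply: le_trans (measure_bigsetU_le_sum _ _ _ _) _ => [k|].
  exact: measurable_defects.
apply: (@le_trans _ _ (\sum_(k : contour_code m) (e ^+ m)%:E)%E).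
  rewrite [leRHS](bigID (fun k => m <= 3 * size (sites k)))%N/=.
  rewrite -[leLHS]adde0 leeD//; last first.
    by apply: sume_ge0 => k _; rewrite lee_fin exprn_ge0.
  apply: lee_sum => k km.
  apply: (le_trans (defects_probability (undup_uniq _) defect_le)).
  by rewrite lee_fin -exprM ler_wiXn2l.
rewrite sumEFin lee_fin sumr_const -[leLHS]mulr_natl.
apply: (@le_trans _ _ ((K ^ m)%N%:R * e ^+ m)).
  by rewrite ler_wpM2r ?exprn_ge0// ler_nat; exact: card_code.
rewrite natrX -exprMn.
suff -> : K%:R * e = 2^-1 by [].
by rewrite /e invfM mulrCA divff ?mulr1// pnatr_eq0 -lt0n.
Qed.

Lemma ae_transient o :
  {ae P, forall w, transient (rotor_walk (@clockwise M) o (rho w))}.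
Proof.
have mc m : measurable (contours m).
  by apply: bigsetU_measurable => k _; exact: measurable_defects.
exists (lim_sup_set contours); split.
- by apply: bigcap_measurable => // n _; exact: bigcup_measurable.
- apply: lim_sup_set_cvg0 => //.
  apply: (@le_lt_trans _ _ (2%:E)%E); last exact: ltry.
  apply: (le_trans _ (epsilon_trick0 predT (ler0n R 2))).
  apply: lee_nneseries => // m _.
  apply: (le_trans (contours_probability m)).
  by rewrite lee_fin natrX exprS invfM mulrA divff ?mul1r ?exprVn//.
- move=> w /= /contrapT rec n _; case: rhoP => rho_config _ _ _.
  have [m [a [c [b [nm am sc sb [ms md]]]]]] :=
    recurrent_contour n (rho_config w) rec.
  exists m => //.
  have am' : (a < m.+1)%N by [].
  pose k : contour_code m :=
    (Ordinal am', Tuple (introT eqP sc), Tuple (introT eqP sb)).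
  rewrite /contours -bigcup_seq_cond; exists k => //=.
  by rewrite mem_index_enum.
Qed.

End Defects.

Theorem proposition1p3 (R : realType) :
  exists M0 : nat, forall M : nat, (M0 <= M)%N ->
  forall (d : measure_display) (Omega : measurableType d)
    (P : probability Omega R) (rho0 : Omega -> leafy_vertex M -> leafy_vertex M)
    (x0 : leafy_vertex M),
  indep_uniform_rotors (@clockwise M) P rho0 ->
  {ae P, forall w, transient (rotor_walk (@clockwise M) x0 (rho0 w))}.
Proof.
have [K K0 cardK] := card_contour_code.
pose c : R := 3%:R / ((2 * K%:R)^-1) ^+ 3.
exists (Num.bound c) => M cM d Omega P rho0 x0 rhoP.
apply: (ae_transient rhoP K0 cardK).
have c0 : 0 <= c by rewrite divr_ge0// exprn_ge0// invr_ge0 mulr_ge0.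
rewrite ler_pdivrMr ?ltr0n// mulrC -ler_pdivrMr; last first.
  by rewrite exprn_gt0// invr_gt0 mulr_gt0 ?ltr0n.
apply: (le_trans (ltW (archi_boundP c0))).
by rewrite ler_nat (leq_trans cM)// leq_addl.
Qed.
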